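(* Let $G,\alpha,\beta,a,b$ be as in the setting below (so $(A_1)$, $(A_2)$ hold and $\Omega_a=\{a=0\}$, $\Omega_b=\{b=0\}$). For each $\lambda>0$ let $(u_\lambda,v_\lambda)\in H_\lambda$ be a ground state solution of system (S$_\lambda$) (a weak solution lying in $\mathcal N_\lambda$ with $J_\lambda(u_\lambda,v_\lambda)=c_{\mathcal N_\lambda}$). Then for any sequence $\lambda_n\to\infty$ there is a subsequence along which $(u_{\lambda_n},v_{\lambda_n})$ converges strongly in $H$ to some $(u,v)$ with $u\equiv0$ outside $\Omega_a$, $v\equiv0$ outside $\Omega_b$, $(u,v)\in H_\Omega$, and $(u,v)$ is a ground state solution of the Dirichlet system (D) (a weak solution lying in $\mathcal N_\Omega$ with $J_\Omega(u,v)=c_{\mathcal N_\Omega}$).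
   Context: $G=(V,E)$ locally finite connected graph, $w_{xy}=w_{yx}>0$, measure $\mu\ge\mu_{\min}>0$; $\Delta u(x)=\frac1{\mu(x)}\sum_{y\sim x}w_{xy}(u(y)-u(x))$, $\Gamma(u,v)(x)=\frac1{2\mu(x)}\sum_{y\sim x}w_{xy}(u(y)-u(x))(v(y)-v(x))$, $|\nabla u|^2=\Gamma(u,u)$, $\int_Af\,d\mu=\sum_{x\in A}\mu(x)f(x)$. $\alpha,\beta>1$. $(A_1)$: $a,b:V\to\mathbb{R}$, $a,b\ge0$, and $\Omega_a=\{a=0\}$, $\Omega_b=\{b=0\}$, $\Omega_a\cap\Omega_b$ are non-empty bounded domains (uniformly bounded graph distance). $(A_2)$: for some $x_0$, $a(x),b(x)\to+\infty$ as $d(x,x_0)\to\infty$. $H=W^{1,2}(V)^2$ with $\|(u,v)\|_H^2=\int_V(|\nabla u|^2+|\nabla v|^2+u^2+v^2)d\mu$. $H_\lambda=\{(u,v)\in H:\int_V(\lambda au^2+\lambda bv^2)d\mu<\infty\}$, $\|(u,v)\|_{H_\lambda}^2=\int_V(|\nabla u|^2+|\nabla v|^2+(\lambda a+1)u^2+(\lambda b+1)v^2)d\mu$, $J_\lambda(u,v)=\frac12\|(u,v)\|_{H_\lambda}^2-\frac1{\alpha+\beta}\int_V|u|^\alpha|v|^\beta d\mu$; (S$_\lambda$): $-\Delta u+(\lambda a+1)u=\frac{\alpha}{\alpha+\beta}|u|^{\alpha-2}u|v|^\beta$, $-\Delta v+(\lambda b+1)v=\frac{\beta}{\alpha+\beta}|u|^\alpha|v|^{\beta-2}v$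 on $V$, weak solutions being critical points of $J_\lambda$ on $H_\lambda$; $\mathcal N_\lambda=\{(u,v)\ne0:\langle J_\lambda'(u,v),(u,v)\rangle=0\}$, $c_{\mathcal N_\lambda}=\inf_{\mathcal N_\lambda}J_\lambda$. For $\Omega\subset V$: $\partial\Omega=\{y\notin\Omega:\exists x\in\Omega, xy\in E\}$, $\overline\Omega=\Omega\cup\partial\Omega$; $W_0^{1,2}(\Omega)$ = completion of functions supported in $\Omega$ under $(\int_{\overline\Omega}|\nabla u|^2+\int_\Omega u^2)^{1/2}$. $H_\Omega=W_0^{1,2}(\Omega_a)\times W_0^{1,2}(\Omega_b)$, $J_\Omega(u,v)=\frac12\int_{\overline\Omega_a\cup\overline\Omega_b}(|\nabla u|^2+|\nabla v|^2)d\mu+\frac12\int_{\Omega_a\cup\Omega_b}(u^2+v^2)d\mu-\frac1{\alpha+\beta}\int_{\Omega_a\cup\Omega_b}|u|^\alpha|v|^\beta d\mu$; (D): $-\Delta u+u=\frac{\alpha}{\alpha+\beta}|u|^{\alpha-2}u|v|^\beta$ in $\Omega_a$, $-\Delta v+v=\frac{\beta}{\alpha+\beta}|u|^\alpha|v|^{\beta-2}v$ in $\Omega_b$, $u=0$ on $\partial\Omega_a$, $v=0$ on $\partial\Omega_b$, weak solutions being critical points of $J_\Omega$ on $H_\Omega$; $\mathcal N_\Omega$, $c_{\mathcal N_\Omega}$ defined analogously. *)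

(* Defs.v *)
From HB Require Import structures.
From mathcomp Require Import all_boot all_order all_algebra.
From mathcomp Require Import all_classical all_reals all_analysis.
Set Implicit Arguments. Unset Strict Implicit. Unset Printing Implicit Defensive.
Import Order.TTheory GRing.Theory Num.Theory.
Import numFieldNormedType.Exports.
Local Open Scope classical_set_scope.
Local Open Scope ring_scope.

Section GraphDefs.
Variables (R : realType) (V : choiceType).
(* nb x : the (finite) list of neighbours of x  -- local finiteness is built in *)
Variables (nb : V -> seq V) (w : V -> V -> R) (mu : V -> R).

Definition adj (x y : V) : bool := y \in nb x.

Definition is_path (x : V) (p : seq V) (y : V) : bool :=
  path adj x p && (last x p == y).

Definition graph_setting : Prop :=
  [/\ (forall x, uniq (nb x)) /\ (forall x y, adj x y = adj y x),
      (forall x, ~~ adj x x),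
      (forall x y, adj x y -> w x y = w y x /\ 0 < w x y),
      (forall x y, exists p, is_path x p y) &
      (exists mumin : R, 0 < mumin /\ forall x, mumin <= mu x)].

Definition bounded_set (A : set V) : Prop :=
  exists (x0 : V) (N : nat), forall x, A x -> exists p, is_path x0 p x /\ (size p <= N)%N.

(* int_A f dmu, for f >= 0, as an extended real *)
Definition vint (A : set V) (f : V -> R) : \bar R :=
  (\esum_(x in A) (mu x * f x)%:E)%E.

Definition grad2 (u : V -> R) (x : V) : R :=
  (2 * mu x)^-1 * \sum_(y <- nb x) w x y * (u y - u x) ^+ 2.

Definition Hnorm2 (u v : V -> R) : \bar R :=
  vint setT (fun x => grad2 u x + grad2 v x + u x ^+ 2 + v x ^+ 2).

Definition inH (u v : V -> R) : Prop := (Hnorm2 u v < +oo)%E.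

Variables (alpha beta : R) (a b : V -> R).

Definition A1 : Prop :=
  [/\ (forall x, 0 <= a x), (forall x, 0 <= b x),
      [set x | a x = 0] !=set0 /\ bounded_set [set x | a x = 0],
      [set x | b x = 0] !=set0 /\ bounded_set [set x | b x = 0] &
      [set x | a x = 0 /\ b x = 0] !=set0 /\ bounded_set [set x | a x = 0 /\ b x = 0]].

Definition A2 : Prop :=
  exists x0 : V, forall M : R, exists N : nat, forall x,
    (forall p, is_path x0 p x -> (N <= size p)%N) -> M <= a x /\ M <= b x.

Definition inHlam (lam : R) (u v : V -> R) : Prop :=
  inH u v /\ (vint setT (fun x => (lam * a x * u x ^+ 2 + lam * b x * v x ^+ 2)%R) < +oo)%E.

Definition Hlamnorm2 (lam : R) (u v : V -> R) : \bar R :=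
  vint setT (fun x => grad2 u x + grad2 v x + (lam * a x + 1) * u x ^+ 2
                      + (lam * b x + 1) * v x ^+ 2).

Definition nonlin (u v : V -> R) (x : V) : R := (`|u x| `^ alpha) * (`|v x| `^ beta).

Definition Jlam (lam : R) (u v : V -> R) : R :=
  fine (Hlamnorm2 lam u v) / 2 - fine (vint setT (nonlin u v)) / (alpha + beta).

Definition Oma : set V := [set x | a x = 0].
Definition Omb : set V := [set x | b x = 0].
Definition closure_g (A : set V) : set V := A `|` [set y | exists2 x, A x & adj x y].

(* W_0^{1,2}(Omega) for the (finite) set Omega: completion of the functions
   supported in Omega, i.e. (finite dimension) the functions supported in Omega *)
Definition W0 (A : set V) (u : V -> R) : Prop := forall x, ~ A x -> u x = 0.

Definition HOm (u v : V -> R) : Prop := W0 Oma u /\ W0 Omb v.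

Definition JOm (u v : V -> R) : R :=
  fine (vint (closure_g Oma `|` closure_g Omb) (fun x => grad2 u x + grad2 v x)) / 2
  + fine (vint (Oma `|` Omb) (fun x => u x ^+ 2 + v x ^+ 2)) / 2
  - fine (vint (Oma `|` Omb) (nonlin u v)) / (alpha + beta).

End GraphDefs.

Section Variational.
Variables (R : realType) (V : choiceType).
Variables (J : (V -> R) -> (V -> R) -> R) (S : (V -> R) -> (V -> R) -> Prop).

Definition Jline (u v phi psi : V -> R) : R -> R :=
  fun t => J (fun x => u x + t * phi x) (fun x => v x + t * psi x).

Definition dJ0 (u v phi psi : V -> R) : Prop :=
  derivable (Jline u v phi psi) 0 1 /\ derive1 (Jline u v phi psi) 0 = 0.

(* weak solution = critical point of J on the space S *)
Definition critical (u v : V -> R) : Prop :=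
  S u v /\ forall phi psi, S phi psi -> dJ0 u v phi psi.

Definition nehari (u v : V -> R) : Prop :=
  [/\ S u v, ~ (u = (fun _ => 0) /\ v = (fun _ => 0)) & dJ0 u v u v].

Definition c_nehari : \bar R :=
  ereal_inf [set (J p.1 p.2)%:E | p in [set p | nehari p.1 p.2]].

Definition ground_state (u v : V -> R) : Prop :=
  [/\ critical u v, nehari u v & (J u v)%:E = c_nehari].

End Variational.

(* Main.v *)
Require Import Defs.
From HB Require Import structures.
From mathcomp Require Import all_boot all_order all_algebra.
From mathcomp Require Import all_classical all_reals all_analysis.
From mathcomp Require Import ring lra.
Import Order.TTheory GRing.Theory Num.Theory.
Import numFieldNormedType.Exports.
Local Open Scope classical_set_scope.
Local Open Scope ring_scope.

Set Implicit Arguments.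
Unset Strict Implicit.
Unset Printing Implicit Defensive.

(* Write N for the squared norm of H_lambda (on H_Omega it does not depend on
   lambda), B for the integral of |u|^alpha |v|^beta and p = alpha + beta > 2.
   Along a ray J is t^2 N / 2 - t^p B / p, so the Nehari set is {N = B}, where
   J = (1/2 - 1/p) N, and J_lambda extends J_Omega. Hence the norms N_n of the
   ground states are at most the least Nehari norm of the Dirichlet problem,
   while the embedding of l^2 in l^infinity bounds them from below. The
   potentials are bounded away from zero off the finite sets Omega_a, Omega_b,
   so u_n^2 and v_n^2 have total mass O(1 / lambda_n) there, and
   Bolzano-Weierstrass is needed for finitely many coordinates only. If N_n
   tends to L, the limit satisfies N <= L <= B; rescaling it by some t <= 1 to
   the Nehari set gives L <= t^2 N <= N, so N = L = B and t = 1. Convergence of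
   the norms then upgrades to strong convergence because the limit has finite
   support. *)

(** * Real analysis *)

Lemma derivable_comp (R : realType) (f g : R -> R) (x : R) :
  derivable f (g x) 1 -> derivable g x 1 -> derivable (f \o g) x 1.
Proof.
move=> /derivableP df /derivableP dg.
by have [] := is_derive1_comp df dg.
Qed.

Lemma derivable_bigsum (R : realType) (I : Type) (s : seq I) (f : I -> R -> R)
    (x : R) :
  (forall i, derivable (f i) x 1) ->
  derivable (fun t => \sum_(i <- s) f i t) x 1.
Proof.
move=> df; elim: s => [|i s IH].
  rewrite (_ : (fun _ => _) = cst 0); first exact: derivable_cst.
  by apply/funext => t; rewrite big_nil.
rewrite (_ : (fun _ => _) = f i + (fun t => \sum_(i <- s) f i t)).
  exact: derivableD.
by apply/funext => t; rewrite big_cons.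
Qed.

Lemma derivable_continuous (R : realType) (f : R -> R) (x : R) :
  derivable f x 1 -> {for x, continuous f}.
Proof. by move=> /derivable1_diffP/differentiable_continuous. Qed.

(* Superlinearity makes the function differentiable at the origin too. *)
Lemma derivable_norm_powR (R : realType) (r x : R) : 1 < r ->
  derivable (fun y : R => `|y| `^ r) x 1.
Proof.
move=> r1; have [x0|x0|->] := ltgtP x 0.
- have H : \forall y \near x, ((@powR R ^~ r) \o -%R) y = `|y| `^ r.
    near=> y; rewrite /= ltr0_norm//.
    by near: y; exact: lt_nbhsl.
  refine (near_eq_derivable H _).
  apply: derivable_comp; last by apply: derivableN; exact: derivable_id.
  by apply: derivable_powR; rewrite in_itv/= andbT oppr_gt0.
- have H : \forall y \near x, y `^ r = `|y| `^ r.
    near=> y; rewrite /= gtr0_norm//.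
    by near: y; exact: lt_nbhsr.
  refine (near_eq_derivable H _).
  by apply: derivable_powR; rewrite in_itv/= andbT.
- apply/cvg_ex; exists 0; apply/cvgr0Pnorm_le => e e0.
  have r0 : 0 < r - 1 by rewrite subr_gt0.
  near=> h.
  have h0 : h != 0 by near: h; exact: nbhs_dnbhs_neq.
  rewrite /= addr0 /GRing.scale/= mulr1 normr0 powR0 ?subr0; last first.
    by rewrite gt_eqF// (lt_trans _ r1).
  rewrite normrM normfV norm_powR// normr_id.
  rewrite -(@mulr_powRB1 _ _ r)// ?(lt_trans _ r1)//.
  rewrite mulrA mulVf ?normr_eq0// mul1r.
  (* At the origin the difference quotient has norm |h|^(r-1). Writing [e] as a power with exponent
     r - 1 shows that |h| <= e^(1/(r-1)) suffices. *)
  have -> : e = (e `^ (r - 1)^-1) `^ (r - 1).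
    by rewrite -powRrM mulVf ?gt_eqF// powRr1// ltW.
  apply: ge0_ler_powR; rewrite ?nnegrE ?powR_ge0 ?(ltW r0) ?normr_ge0//.
  near: h; apply: dnbhs0_le; exact: powR_gt0.
Unshelve. all: by end_near. Qed.

(** * Limits of finite sums and extraction of subsequences *)

Lemma cvg_bigsum (R : realType) (I : eqType) (s : seq I) (f : I -> nat -> R)
    (l : I -> R) :
  (forall i, i \in s -> f i n @[n --> \oo] --> l i) ->
  (\sum_(i <- s) f i n) @[n --> \oo] --> \sum_(i <- s) l i.
Proof.
elim: s => [|i s IH] h.
  rewrite big_nil (_ : (fun _ => _) = cst 0); first exact: cvg_cst.
  by apply/funext => t; rewrite big_nil.
rewrite big_cons (_ : (fun _ => _) = f i + (fun t => \sum_(i <- s) f i t)).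
  apply: cvgD; first by apply: h; rewrite mem_head.
  by apply: IH => j js; apply: h; rewrite inE js orbT.
by apply/funext => t; rewrite big_cons.
Qed.

Lemma extraction_ge (s : nat -> nat) :
  (forall n, (s n < s n.+1)%N) -> forall n, (n <= s n)%N.
Proof. by move=> h; elim=> // n IH; exact: leq_ltn_trans IH (h n). Qed.

Lemma cvg_extraction (s : nat -> nat) :
  (forall n, (s n < s n.+1)%N) -> s n @[n --> \oo] --> \oo.
Proof.
move=> /extraction_ge h; apply/cvgnyPge => A; near=> n.
apply: leq_trans (h n); near: n; exact: nbhs_infty_ge.
Unshelve. all: by end_near. Qed.

Lemma extraction_mono (s : nat -> nat) :
  (forall n, (s n < s n.+1)%N) -> forall m n, (m < n)%N -> (s m < s n)%N.
Proof.
move=> h m; elim=> // n IH; rewrite ltnS leq_eqVlt => /orP[/eqP -> //|/IH mn].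
exact: ltn_trans mn (h n).
Qed.

(** Induction on [r]: each new index costs one further extraction, and the convergences already
    obtained survive it. *)
Lemma bolzano_weierstrass_family (R : realType) (I : eqType) (r : seq I)
    (f : I -> nat -> R) (M : R) :
  (forall i n, `|f i n| <= M) ->
  exists2 s : nat -> nat, (forall n, (s n < s n.+1)%N) &
    forall i, i \in r -> cvgn (f i \o s).
Proof.
move=> fM; elim: r => [|i r [s s_incr IH]]; first by exists id.
have [|t /increasing_seqP t_incr cvt] := @bolzano_weierstrass _ (f i \o s).
  exists M; split; first exact: num_real.
  by move=> x Mx n _ /=; rewrite (le_trans (fM _ _))// ltW.
exists (s \o t).
  by move=> n /=; apply: extraction_mono => //; exact: t_incr.
move=> j; rewrite inE => /orP[/eqP ->//|/IH /cvg_ex[l jl]].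
apply/cvg_ex; exists l; apply: (cvg_comp _ _ _ jl).
by apply: cvg_extraction => n; exact: t_incr.
Qed.

Section PointwiseDerivable.
Variables (R : realType) (f g : R -> R) (x : R).
Hypotheses (df : derivable f x 1) (dg : derivable g x 1).

Lemma derivable_fun_add : derivable (fun t => f t + g t) x 1.
Proof. by have -> : (fun t => f t + g t) = f + g by []; apply: derivableD. Qed.

Lemma derivable_fun_sub : derivable (fun t => f t - g t) x 1.
Proof. by have -> : (fun t => f t - g t) = f - g by []; apply: derivableB. Qed.

Lemma derivable_fun_mul : derivable (fun t => f t * g t) x 1.
Proof. by have -> : (fun t => f t * g t) = f * g by []; apply: derivableM. Qed.

Lemma derivable_fun_sqr : derivable (fun t => f t ^+ 2) x 1.
Proof.
have -> : (fun t => f t ^+ 2) = f * f by apply/funext => t; rewrite expr2.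
exact: derivableM.
Qed.

Lemma derivable_fun_mulc (c : R) : derivable (fun t => c * f t) x 1.
Proof.
have -> : (fun t => c * f t) = cst c * f by [].
by apply: derivableM => //; exact: derivable_cst.
Qed.

End PointwiseDerivable.

(** Eventually f^2 <= C / l. With [f] the values at a vertex where a potential is non-zero, this
    makes the limit vanish off its zero set. *)
Lemma cvg0_sqr_mul_bounded (R : realType) (f l : nat -> R) (C : R) :
  (forall n, f n ^+ 2 * l n <= C) -> l n @[n --> \oo] --> +oo ->
  f n @[n --> \oo] --> (0 : R).
Proof.
move=> fC lcvg; apply/cvgr0Pnorm_le => e e0; near=> n.
have e2 : 0 < e ^+ 2 by rewrite exprn_gt0.
have ln0 : 0 < l n by near: n; exact: cvgry_gt.
have Cl : C <= e ^+ 2 * l n.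
  by rewrite mulrC -ler_pdivrMr//; near: n; exact: cvgry_ge.
rewrite -(@ler_pXn2r _ 2) ?nnegrE// ?(ltW e0)// real_normK ?num_real//.
by rewrite -(ler_pM2r ln0); exact: le_trans (fC n) Cl.
Unshelve. all: by end_near. Qed.

Lemma is_derive_ray (R : realType) (p N B : R) : 1 < p ->
  is_derive (0 : R) (1 : R) (fun t : R => (1 + t) ^+ 2 * N / 2 - `|1 + t| `^ p * B / p)
    (N - B).
Proof.
move=> p1.
have dshift : is_derive (0 : R) 1 (fun t : R => 1 + t) 1.
  have -> : (fun t : R => 1 + t) = cst 1 + id by [].
  by apply: is_derive_eq; rewrite add0r.
have dpow : is_derive (0 : R) 1 (fun t : R => `|1 + t| `^ p) p.
  have dnorm : is_derive (1 + 0 : R) 1 (fun y : R => `|y| `^ p) p.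
    apply: DeriveDef; first exact: derivable_norm_powR.
    rewrite addr0.
    have /near_eq_derive -> : \forall y \near (1 : R), `|y| `^ p = y `^ p.
      near=> y; rewrite gtr0_norm//; near: y; exact: lt_nbhsr.
    have [_ ->] := is_derive1_powR p (@ltr01 R).
    by rewrite powR1 mulr1.
  by have := is_derive1_comp dnorm dshift; rewrite mulr1.
have -> : (fun t : R => (1 + t) ^+ 2 * N / 2 - `|1 + t| `^ p * B / p) =
    (N / 2) *: ((fun t : R => 1 + t) ^+ 2) -
    (B / p) *: (fun t : R => `|1 + t| `^ p).
  apply/funext => t; rewrite !fctE /GRing.scale/=; ring.
apply: is_derive_eq; rewrite /GRing.scale/= addr0.
have p0 : p != 0 by rewrite gt_eqF//; lra.
field.
Unshelve. all: by end_near. Qed.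

(** The perturbation of a pair along itself is the ray (1 + t)(u, v), so a formula for [J] on rays
    yields both differentiability and the derivative [N - B]. It serves [Jlam] and [JOm] alike. *)
Lemma dJ0_ray (R : realType) (V : choiceType) (J : (V -> R) -> (V -> R) -> R)
    (u v : V -> R) (p N B : R) : 1 < p ->
  (forall k, J (fun x => k * u x) (fun x => k * v x) =
     k ^+ 2 * N / 2 - `|k| `^ p * B / p) ->
  dJ0 J u v u v <-> N = B.
Proof.
move=> p1 JE; have dJ := is_derive_ray N B p1.
have JlineE : Jline J u v u v =
    (fun t : R => (1 + t) ^+ 2 * N / 2 - `|1 + t| `^ p * B / p).
  apply/funext => t; rewrite -JE /Jline.
  by congr J; apply/funext => x; rewrite mulrDl mul1r.
rewrite /dJ0 JlineE derive1E; have [der ->] := dJ.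
split=> [[_ /eqP]|NB]; first by rewrite subr_eq0 => /eqP.
by split => //; rewrite NB subrr.
Qed.

(* [p ln n - 2 ln b] is, up to constants, the logarithm of the least energy on
   the ray through the point at parameter [t]; its critical points with
   [n = b] are those of the energy itself. *)
Lemma is_derive_energy_min (R : realType) (n b : R -> R) (p : R) : 2 < p ->
  (forall t, derivable n t 1) -> (forall t, derivable b t 1) ->
  0 < n 0 -> n 0 = b 0 ->
  (forall t, 0 < n t -> 0 < b t ->
     (p - 2) * ln (n 0) <= p * ln (n t) - 2 * ln (b t)) ->
  is_derive (0 : R) (1 : R) (fun t => n t / 2 - b t / p) 0.
Proof.
move=> p2 dn db n0 nb0 hmin.
have b0 : 0 < b 0 by rewrite -nb0.
pose h : R -> R := p *: (@ln R \o n) - 2 *: (@ln R \o b).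
(* By continuity both functions stay positive on an interval around 0, where their logarithms are
   differentiable. *)
have : \forall t \near (0 : R), 0 < n t /\ 0 < b t.
  have near_pos (f : R -> R) : derivable f 0 1 -> 0 < f 0 ->
      \forall t \near (0 : R), 0 < f t.
    by move=> /derivable_continuous cf; exact: cvgr_gt cf _.
  by apply: filterI; exact: near_pos.
move=> /nbhs_ballP[d /= d0 dP].
have pos t : t \in `]- d, d[ -> 0 < n t /\ 0 < b t.
  move=> td; apply: dP; rewrite /ball/= sub0r normrN ltr_norml.
  by move: td; rewrite in_itv.
have dln (f : R -> R) t : derivable f t 1 -> 0 < f t ->
    is_derive t 1 (@ln R \o f) ((f t)^-1 * 'D_1 f t).
  by move=> /derivableP df ft; apply: is_derive1_comp; exact: is_derive1_ln.
have dh t : 0 < n t -> 0 < b t -> is_derive t 1 h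
    (p * ((n t)^-1 * 'D_1 n t) - 2 * ((b t)^-1 * 'D_1 b t)).
  move=> nt bt; have ? := dln n t (dn t) nt; have ? := dln b t (db t) bt.
  exact: is_derive_eq.
(* Since [n 0 = b 0], the value of [h] at 0 is (p - 2) ln (n 0), the lower bound in [hmin]. So 0 is
   a minimum, and h'(0) = 0 becomes p n'(0) = 2 b'(0). *)
have h0 : is_derive (0 : R) 1 h 0.
  apply: (@derive1_at_min _ _ (- d) d).
  - by rewrite ge0_cp// ltW.
  - by move=> t /pos[nt bt]; have [] := dh t nt bt.
  - by rewrite in_itv/= oppr_lt0 d0.
  - move=> t /pos[nt bt]; rewrite /h !fctE /GRing.scale/=.
    by apply: le_trans (hmin t nt bt); rewrite -nb0; lra.
have [_ ] := h0; have [_ ->] := dh 0 n0 b0; rewrite -nb0 => E.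
have n_neq0 : n 0 != 0 by rewrite gt_eqF.
have {}E : p * 'D_1 n 0 = 2 * 'D_1 b 0.
  move: E => /(congr1 (fun z => n 0 * z)); rewrite mulr0 mulrBr.
  rewrite !(mulrCA (n 0)) !mulKf//.
  by move=> /eqP; rewrite subr_eq0 => /eqP.
have -> : (fun t => n t / 2 - b t / p) = 2^-1 *: n - p^-1 *: b.
  by apply/funext => t; rewrite !fctE /GRing.scale/= mulrC [b t / _]mulrC.
have /derivableP ? := dn 0; have /derivableP ? := db 0.
apply: is_derive_eq; rewrite /GRing.scale/=.
have p0 : p != 0 by rewrite gt_eqF//; lra.
apply: (mulfI (_ : 2 * p != 0)); first by rewrite mulf_neq0.
rewrite mulr0 mulrBr; apply/eqP; rewrite subr_eq0; apply/eqP.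
have -> : 2 * p * (2^-1 * 'D_1 n 0) = p * 'D_1 n 0 by field.
by rewrite E; field.
Qed.

(** * Sums over the vertices *)

(** With m the larger of x and y, the product is at most m^(p-2) m^2, where p = alpha + beta; then m
    <= K in the first factor and m^2 <= x^2 + y^2 in the second. *)
Lemma nonlin_le (R : realType) (alpha beta K x y : R) :
  1 < alpha -> 1 < beta -> 0 <= x <= K -> 0 <= y <= K ->
  x `^ alpha * y `^ beta <= K `^ (alpha + beta - 2) * (x ^+ 2 + y ^+ 2).
Proof.
move=> a1 b1 /andP[x0 xK] /andP[y0 yK]; set m := Num.max x y.
have m0 : 0 <= m by rewrite le_max x0.
have mK : m <= K by rewrite ge_max xK.
have p2 : 0 <= alpha + beta - 2 by lra.
apply: (@le_trans _ _ (m `^ (alpha + beta))).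
  rewrite powRD; last by rewrite gt_eqF//; lra.
  apply: ler_pM; rewrite ?powR_ge0//; apply: ge0_ler_powR;
    rewrite ?nnegrE ?le_max ?lexx ?orbT//; lra.
rewrite -[X in m `^ X](subrK 2) (@powRD _ m); last by rewrite gt_eqF//; lra.
rewrite powR_mulrn//; apply: ler_pM; rewrite ?powR_ge0 ?sqr_ge0//.
  by apply: ge0_ler_powR; rewrite ?nnegrE// (le_trans m0).
by rewrite /m; case: (leP x y) => _; rewrite ?lerDl ?lerDr sqr_ge0.
Qed.

Section Graph.
Variables (R : realType) (V : choiceType).
Variables (nb : V -> seq V) (w : V -> V -> R) (mu : V -> R).
Hypothesis hG : graph_setting nb w mu.

Lemma mu_gt0 x : 0 < mu x.
Proof. by have [_ _ _ _ [m [m0 mx]]] := hG; exact: lt_le_trans (mx x). Qed.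

Lemma mu_ge0 x : 0 <= mu x. Proof. exact/ltW/mu_gt0. Qed.

#[local] Hint Resolve mu_gt0 mu_ge0 : core.

(** Balls are finite by local finiteness: the last vertex of a path of length N + 1 is a neighbour
    of a vertex in the ball of radius N. *)
Lemma bounded_ball_seq (x0 : V) (N : nat) :
  exists s : seq V, forall x p,
    is_path nb x0 p x -> (size p <= N)%N -> x \in s.
Proof.
elim: N => [|N [s IH]].
  exists [:: x0] => x [|//] /andP[_ /eqP <-] _; exact: mem_head.
exists (s ++ flatten [seq nb y | y <- s]) => x p; rewrite mem_cat.
case: (lastP p) => [|q y] pp; first by move=> _; rewrite (IH _ _ pp).
rewrite size_rcons ltnS => qN.
move: pp; rewrite /is_path last_rcons rcons_path => /andP[/andP[pq aq] /eqP yx].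
apply/orP; right; apply/flattenP; exists (nb (last x0 q)).
  by apply: map_f; apply: (IH _ q) => //; rewrite /is_path pq eqxx.
by rewrite -yx.
Qed.

Lemma bounded_set_seq (A : set V) : Defs.bounded_set nb A ->
  exists s : seq V, forall x, A x -> x \in s.
Proof.
move=> [x0 [N h]]; have [s sP] := bounded_ball_seq x0 N.
by exists s => x /h[p [pp pN]]; exact: sP pp pN.
Qed.

Lemma closure_g_seq (A : set V) : Defs.bounded_set nb A ->
  exists s : seq V, forall x, closure_g nb A x -> x \in s.
Proof.
move=> /bounded_set_seq[s sP]; exists (s ++ flatten [seq nb y | y <- s]) => x.
rewrite mem_cat => -[/sP -> //|[y /sP ys yx]].
by apply/orP; right; apply/flattenP; exists (nb y) => //; exact: map_f.
Qed.

Lemma grad2_ge0 u x : 0 <= grad2 nb w mu u x.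
Proof.
have [_ _ hw _ _] := hG.
apply: mulr_ge0; first by rewrite invr_ge0 mulr_ge0.
rewrite big_seq; apply: sumr_ge0 => y yx.
by rewrite mulr_ge0 ?sqr_ge0// ltW// (hw x y yx).2.
Qed.

Lemma grad2Z u (k : R) x :
  grad2 nb w mu (fun y => k * u y) x = k ^+ 2 * grad2 nb w mu u x.
Proof.
rewrite /grad2 mulrCA; congr (_ * _); rewrite mulr_sumr.
by apply: eq_bigr => y _; rewrite -mulrBr exprMn mulrCA.
Qed.

Lemma grad2_out (A : set V) u x : W0 A u -> ~ closure_g nb A x ->
  grad2 nb w mu u x = 0.
Proof.
have [[_ symG] _ _ _ _] := hG.
move=> uA xA; rewrite /grad2 big_seq big1 ?mulr0// => y yx.
rewrite !uA ?subrr ?expr0n ?mulr0// => Az; apply: xA; first by left.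
by right; exists y => //; rewrite -symG.
Qed.

Section vint.
Implicit Types (f g : V -> R) (A : set V).

Lemma vint_ge0 A f : (forall x, 0 <= f x) -> (0 <= vint mu A f)%E.
Proof. by move=> f0; apply: esum_ge0 => x _; rewrite lee_fin mulr_ge0. Qed.

Lemma le_vint A f g : (forall x, f x <= g x) -> (vint mu A f <= vint mu A g)%E.
Proof.
by move=> fg; apply: le_esum => x _; rewrite lee_fin ler_wpM2l.
Qed.

Lemma vintD A f g : (forall x, 0 <= f x) -> (forall x, 0 <= g x) ->
  (vint mu A (fun x => f x + g x)%R = vint mu A f + vint mu A g)%E.
Proof.
move=> f0 g0; rewrite /vint -esumD; last 2 first.
  by move=> x _; rewrite lee_fin mulr_ge0.
  by move=> x _; rewrite lee_fin mulr_ge0.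
by apply: eq_esum => x _; rewrite mulrDr EFinD.
Qed.

Lemma vintZ A f (k : R) : 0 <= k -> (forall x, 0 <= f x) ->
  (vint mu A (fun x => (k * f x)%R) = k%:E * vint mu A f)%E.
Proof.
move=> k0 f0.
(* One inequality is enough: applied to [k * f] with the factor [k^-1], it gives the converse when
   [k] is positive. *)
have le_vintZ g (c : R) : 0 <= c -> (forall x, 0 <= g x) ->
    (vint mu A (fun x => (c * g x)%R) <= c%:E * vint mu A g)%E.
  move=> c0 g0; apply: ge_ereal_sup => _ [X [finX XA] <-].
  rewrite (_ : (\sum_(x \in X) _)%R =
               (c%:E * (\sum_(x \in X) (mu x * g x)%:E)%R)%E).
    apply: lee_wpmul2l; first by rewrite lee_fin.
    by apply: ereal_sup_ubound; exists X.
  rewrite ge0_mule_fsumr; last by move=> x; rewrite lee_fin mulr_ge0.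
  by apply: eq_fsbigr => x _; rewrite -EFinM mulrCA.
apply/eqP; rewrite eq_le le_vintZ//=.
have [->|k_neq0] := eqVneq k 0.
  by rewrite mul0e; apply: vint_ge0 => x; rewrite mul0r.
have {k_neq0}k_gt0 : 0 < k by rewrite lt_neqAle eq_sym k_neq0.
rewrite -lee_pdivlMl//.
apply: le_trans (le_vintZ (fun x => k * f x) k^-1 _ _); last 2 first.
  by rewrite invr_ge0 ltW.
  by move=> x; rewrite mulr_ge0// ltW.
by apply: le_vint => x; rewrite mulrA mulVf ?gt_eqF// mul1r.
Qed.

Lemma vint_supp A f : (forall x, ~ A x -> f x = 0) ->
  vint mu A f = vint mu setT f.
Proof.
move=> fA; rewrite /vint esum_mkcond; apply: eq_esum => x _.
case: ifPn => // /negP xA; rewrite fA ?mulr0// => Ax; apply: xA; exact: mem_set.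
Qed.

Lemma vint_seq (s : seq V) f : uniq s -> (forall x, 0 <= f x) ->
  (forall x, x \notin s -> f x = 0) ->
  vint mu setT f = (\sum_(x <- s) mu x * f x)%:E.
Proof.
move=> us f0 fs; rewrite -(@vint_supp [set` s]); last first.
  by move=> x /= /negP; exact: fs.
rewrite /vint esum_fset//; last by move=> x _; rewrite lee_fin mulr_ge0.
by rewrite -fsbig_seq// sumEFin.
Qed.

Lemma sum_le_vint (s : seq V) f : uniq s -> (forall x, 0 <= f x) ->
  ((\sum_(x <- s) mu x * f x)%:E <= vint mu setT f)%E.
Proof.
move=> us f0; apply: esum_ge; exists [set` s]; first by split.
by rewrite -fsbig_seq// sumEFin.
Qed.

Lemma vint_le_fin f g (k : R) : (forall x, 0 <= f x) ->
  (forall x, f x <= k * g x) -> 0 <= k -> (forall x, 0 <= g x) ->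
  (vint mu setT g < +oo)%E -> (vint mu setT f < +oo)%E.
Proof.
move=> f0 fg k0 g0 gfin; apply: (@le_lt_trans _ _ (k%:E * vint mu setT g))%E.
  by rewrite -vintZ//; exact: le_vint.
by apply: lte_mul_pinfty.
Qed.

(* Stated without subtraction so that it also holds for infinite integrals. *)
Lemma vint_modify (s : seq V) f g : uniq s ->
  (forall x, 0 <= f x) -> (forall x, 0 <= g x) ->
  (forall x, x \notin s -> f x = g x) ->
  (vint mu setT f + (\sum_(x <- s) mu x * g x)%:E =
   vint mu setT g + (\sum_(x <- s) mu x * f x)%:E)%E.
Proof.
move=> us f0 g0 fg.
have cutE (h : V -> R) : (forall x, 0 <= h x) -> ((\sum_(x <- s) mu x * h x)%:E =
    vint mu setT (fun x => if x \in s then h x else 0%R))%E.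
  move=> h0; rewrite (@vint_seq s)//.
  - by congr EFin; apply: eq_big_seq => x ->.
  - by move=> x; case: ifP.
  - by move=> x /negPf ->.
rewrite !cutE// -!vintD//; last 2 first.
  by move=> x; case: ifP.
  by move=> x; case: ifP.
(* Both sides integrate one function: [f + g] on [s], the common value of [f] and [g] off it. *)
congr vint; apply/funext => x; case: ifPn => [_|/fg -> //]; exact: addrC.
Qed.

End vint.

(** * The system with potential *)

(** Because [fine] sends infinite values to 0, the identity survives at +oo. This is why the ray
    formula [Jlam_ray] asks for no finite integrals. *)
Lemma fineZ (k : R) (y : \bar R) : (0 <= y)%E -> fine (k%:E * y) = k * fine y.
Proof.
case: y => [r| |]// _ /=.
have [->|k0] := eqVneq k 0; first by rewrite mul0e mul0r.
rewrite mulr0; have [kpos|kneg] := ltP 0 k; first by rewrite gt0_muley.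
by rewrite lt0_muley// lt_neqAle k0.
Qed.

Section System.
Variables (alpha beta : R) (a b : V -> R).
Hypotheses (alpha_gt1 : 1 < alpha) (beta_gt1 : 1 < beta).
Hypotheses (hA1 : A1 nb a b) (hA2 : A2 nb a b).

Implicit Types (u v : V -> R) (x : V) (l k : R).

Local Notation p := (alpha + beta).

Lemma p_gt2 : 2 < p. Proof. by have := alpha_gt1; have := beta_gt1; lra. Qed.

Lemma a_ge0 x : 0 <= a x. Proof. by have [] := hA1. Qed.

Lemma b_ge0 x : 0 <= b x. Proof. by have [] := hA1. Qed.

#[local] Hint Resolve a_ge0 b_ge0 : core.

(** [A2] expresses distance at least N by the absence of shorter paths from [x0], which holds off
    the finite ball of radius N. *)
Lemma potential_ge1 : exists s : seq V, forall x, x \notin s ->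
  1 <= a x /\ 1 <= b x.
Proof.
have [x0 h] := hA2; have [N hN] := h 1; have [s sP] := bounded_ball_seq x0 N.
exists s => x xs; apply: hN => q xq; apply: contraNT xs; rewrite -ltnNge => qN.
by apply: sP xq _; exact: ltnW.
Qed.

(* By (A_2) only finitely many values of the potentials are below 1. *)
Lemma potential_gap : exists2 e : R, 0 < e &
  forall x, (a x <> 0 -> e <= a x) /\ (b x <> 0 -> e <= b x).
Proof.
have [s sP] := potential_ge1.
suff [e [e0 e1 es]] : exists e : R, [/\ 0 < e, e <= 1 & forall x, x \in s ->
    (a x <> 0 -> e <= a x) /\ (b x <> 0 -> e <= b x)].
  exists e => // x; have [/es//|/sP[ax bx]] := boolP (x \in s).
  by split=> _; exact: le_trans e1 _.
elim: {sP} s => [|y s [e [e0 e1 IH]]]; first by exists 1; split.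
(* Zeros are replaced by 1, so that a vanishing potential value does not spoil the positivity of the
   minimum. *)
pose c (z : R) := if z == 0 then 1 else z.
have c0 z : 0 <= z -> 0 < c z.
  by rewrite /c; case: eqVneq => //= z0 z1; rewrite lt_neqAle eq_sym z0.
exists (Num.min e (Num.min (c (a y)) (c (b y)))); split.
- by rewrite !lt_min e0 !c0.
- by rewrite ge_min e1.
- move=> x; rewrite inE => /orP[/eqP ->|/IH[ax bx]].
    split=> /eqP/negPf z0; rewrite !ge_min /c z0 lexx ?orbT//.
  by split=> [/ax|/bx] h; rewrite ge_min h.
Qed.

(** [hdens] and [ldens] are the integrands of [Hnorm2] and [Hlamnorm2], named so that pointwise
    estimates pass to the norms by monotonicity of [vint]. *)
Definition hdens (u v : V -> R) (x : V) : R :=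
  grad2 nb w mu u x + grad2 nb w mu v x + u x ^+ 2 + v x ^+ 2.

Definition ldens (l : R) (u v : V -> R) (x : V) : R :=
  grad2 nb w mu u x + grad2 nb w mu v x + (l * a x + 1) * u x ^+ 2
  + (l * b x + 1) * v x ^+ 2.

Lemma hdens_ge0 u v x : 0 <= hdens u v x.
Proof. by rewrite !addr_ge0 ?grad2_ge0 ?sqr_ge0. Qed.

Lemma nonlin_ge0 u v x : 0 <= nonlin alpha beta u v x.
Proof. by rewrite mulr_ge0 ?powR_ge0. Qed.

Lemma ldensE l u v x :
  ldens l u v x = hdens u v x + (l * a x * u x ^+ 2 + l * b x * v x ^+ 2).
Proof. rewrite /ldens /hdens; ring. Qed.

Lemma potential_dens_ge0 l u v x : 0 <= l ->
  0 <= l * a x * u x ^+ 2 + l * b x * v x ^+ 2.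
Proof.
by move=> l0; apply: addr_ge0; apply: mulr_ge0; rewrite ?sqr_ge0 ?mulr_ge0.
Qed.

Lemma ldens_ge0 l u v x : 0 <= l -> 0 <= ldens l u v x.
Proof.
by move=> l0; rewrite ldensE addr_ge0 ?hdens_ge0 ?potential_dens_ge0.
Qed.

Lemma hdens_le_ldens l u v x : 0 <= l -> hdens u v x <= ldens l u v x.
Proof. by move=> l0; rewrite ldensE lerDl potential_dens_ge0. Qed.

Lemma sqr_le_hdens u v x : u x ^+ 2 + v x ^+ 2 <= hdens u v x.
Proof. by rewrite /hdens -addrA lerDr addr_ge0 ?grad2_ge0. Qed.

Lemma ldensZ l u v (k : R) x : ldens l (fun y => k * u y) (fun y => k * v y) x =
  k ^+ 2 * ldens l u v x.
Proof. rewrite /ldens !grad2Z; ring. Qed.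

Lemma hdensZ u v (k : R) x : hdens (fun y => k * u y) (fun y => k * v y) x =
  k ^+ 2 * hdens u v x.
Proof. rewrite /hdens !grad2Z; ring. Qed.

Lemma nonlinZ u v (k : R) x :
  nonlin alpha beta (fun y => k * u y) (fun y => k * v y) x =
  `|k| `^ p * nonlin alpha beta u v x.
Proof.
rewrite /nonlin !normrM !powRM// powRD; last first.
  by rewrite gt_eqF//; have := p_gt2; lra.
ring.
Qed.

Definition normlam (l : R) (u v : V -> R) : R := fine (Hlamnorm2 nb w mu a b l u v).

Definition intnl (u v : V -> R) : R := fine (vint mu setT (nonlin alpha beta u v)).

Lemma Hlamnorm2E l u v : 0 <= l -> inHlam nb w mu a b l u v ->
  Hlamnorm2 nb w mu a b l u v = (normlam l u v)%:E.
Proof.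
move=> l0 [uH uP]; rewrite /normlam fineK//.
have -> : Hlamnorm2 nb w mu a b l u v = (Hnorm2 nb w mu u v +
    vint mu setT (fun x => (l * a x * u x ^+ 2 + l * b x * v x ^+ 2)%R))%E.
  rewrite -vintD.
  - by congr vint; apply/funext => x; exact: ldensE.
  - by move=> x; exact: hdens_ge0.
  - by move=> x; exact: potential_dens_ge0.
rewrite fin_numD !ge0_fin_numE//.
- by rewrite uH uP.
- by apply: vint_ge0 => x; exact: potential_dens_ge0.
- by apply: vint_ge0 => x; exact: hdens_ge0.
Qed.

Lemma Jlam_ray l u v k : 0 <= l ->
  Jlam nb w mu alpha beta a b l (fun x => k * u x) (fun x => k * v x) =
  k ^+ 2 * normlam l u v / 2 - `|k| `^ p * intnl u v / p.
Proof.
move=> l0; rewrite /Jlam /normlam /intnl -!fineZ; last 2 first.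
- by apply: vint_ge0 => x; exact: nonlin_ge0.
- by apply: vint_ge0 => x; exact: ldens_ge0.
rewrite -!vintZ ?sqr_ge0 ?powR_ge0//; last 2 first.
- by move=> x; exact: ldens_ge0.
- by move=> x; exact: nonlin_ge0.
congr (fine _ / 2 - fine _ / p); congr vint; apply/funext => x.
  exact: ldensZ.
exact: nonlinZ.
Qed.

Lemma nehari_lamE l u v : 0 <= l ->
  nehari (Jlam nb w mu alpha beta a b l) (inHlam nb w mu a b l) u v ->
  normlam l u v = intnl u v.
Proof.
move=> l0 [_ _ dJ]; have p1 : 1 < p by have := p_gt2; lra.
by have [/(_ dJ)] := dJ0_ray p1 (fun k => Jlam_ray u v k l0).
Qed.

Lemma sum_le_normlam l u v (s : seq V) : 0 <= l -> inHlam nb w mu a b l u v ->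
  uniq s -> \sum_(x <- s) mu x * ldens l u v x <= normlam l u v.
Proof.
move=> l0 uH us; rewrite -lee_fin -Hlamnorm2E//; apply: sum_le_vint => // x.
exact: ldens_ge0.
Qed.

Lemma ldens_le_normlam l u v x : 0 <= l -> inHlam nb w mu a b l u v ->
  mu x * ldens l u v x <= normlam l u v.
Proof.
by move=> l0 uH; have := @sum_le_normlam l u v [:: x] l0 uH isT; rewrite big_seq1.
Qed.

(** The potential part of a single vertex term, arranged in the shape that [cvg0_sqr_mul_bounded]
    takes. *)
Lemma potential_le_normlam l u v x : 0 <= l -> inHlam nb w mu a b l u v ->
  u x ^+ 2 * l * (mu x * a x) <= normlam l u v /\
  v x ^+ 2 * l * (mu x * b x) <= normlam l u v.
Proof.
move=> l0 uH; have := ldens_le_normlam x l0 uH; rewrite ldensE => h.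
have hd := hdens_ge0 u v x.
have ha : 0 <= l * a x * u x ^+ 2 by rewrite mulr_ge0 ?sqr_ge0 ?mulr_ge0.
have hb : 0 <= l * b x * v x ^+ 2 by rewrite mulr_ge0 ?sqr_ge0 ?mulr_ge0.
split; apply: le_trans h.
  have -> : u x ^+ 2 * l * (mu x * a x) = mu x * (l * a x * u x ^+ 2) by ring.
  by rewrite ler_wpM2l//; lra.
have -> : v x ^+ 2 * l * (mu x * b x) = mu x * (l * b x * v x ^+ 2) by ring.
by rewrite ler_wpM2l//; lra.
Qed.

(** * Bounds from the lower bound on the measure *)

Variable m : R.
Hypotheses (m_gt0 : 0 < m) (m_le : forall x, m <= mu x).

(** Every vertex has mass at least [m], so its own term in the squared norm already controls the
    values there. *)
Lemma sup_le_normlam l u v x : 0 <= l -> inHlam nb w mu a b l u v ->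
  `|u x| <= Num.sqrt (normlam l u v / m) /\
  `|v x| <= Num.sqrt (normlam l u v / m).
Proof.
move=> l0 uH.
have h : (u x ^+ 2 + v x ^+ 2) <= normlam l u v / m.
  rewrite ler_pdivlMr// mulrC; apply: le_trans (ldens_le_normlam x l0 uH).
  apply: ler_pM; rewrite ?addr_ge0 ?sqr_ge0 ?(ltW m_gt0)//.
  exact: le_trans (sqr_le_hdens _ _ _) (hdens_le_ldens _ _ _ _).
have nm0 : 0 <= normlam l u v / m.
  by apply: le_trans h; rewrite addr_ge0 ?sqr_ge0.
by rewrite -!sqrtr_sqr !ler_wsqrtr// (le_trans _ h)// ?lerDl ?lerDr sqr_ge0.
Qed.

Lemma nonlin_le_sup l u v x : 0 <= l -> inHlam nb w mu a b l u v ->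
  nonlin alpha beta u v x <=
  Num.sqrt (normlam l u v / m) `^ (p - 2) * (u x ^+ 2 + v x ^+ 2).
Proof.
move=> l0 uH; have [ux vx] := sup_le_normlam x l0 uH.
rewrite -(real_normK (num_real (u x))) -(real_normK (num_real (v x))).
by apply: nonlin_le => //; apply/andP.
Qed.

Lemma vint_nonlinE l u v : 0 <= l -> inHlam nb w mu a b l u v ->
  vint mu setT (nonlin alpha beta u v) = (intnl u v)%:E.
Proof.
move=> l0 uH; rewrite /intnl fineK// ge0_fin_numE; last first.
  by apply: vint_ge0 => x; exact: nonlin_ge0.
apply: (@vint_le_fin _ (hdens u v) (Num.sqrt (normlam l u v / m) `^ (p - 2))).
- by move=> x; exact: nonlin_ge0.
- move=> x; apply: le_trans (nonlin_le_sup x l0 uH) _.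
  by rewrite ler_wpM2l ?powR_ge0 ?sqr_le_hdens.
- exact: powR_ge0.
- by move=> x; exact: hdens_ge0.
- exact: uH.1.
Qed.

(** On the Nehari set N = B <= K^(p-2) N with K = sqrt (N / m). Since N > 0 this forces K >= 1, that
    is N >= m. *)
Lemma normlam_ge l u v : 0 <= l ->
  nehari (Jlam nb w mu alpha beta a b l) (inHlam nb w mu a b l) u v ->
  m <= normlam l u v.
Proof.
move=> l0 uN; have NB := nehari_lamE l0 uN; have [uH u_neq0 _] := uN.
set N := normlam l u v in NB *.
(* A zero norm would make every vertex term vanish, against non-triviality of the pair. *)
have N0 : 0 < N.
  rewrite lt_neqAle; apply/andP; split; last first.
    by apply/fine_ge0/vint_ge0 => x; exact: ldens_ge0.
  apply: contra_notN u_neq0 => /eqP N0.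
  have uv0 x : u x ^+ 2 + v x ^+ 2 = 0.
    apply/eqP; rewrite eq_le addr_ge0 ?sqr_ge0// andbT.
    apply: le_trans (sqr_le_hdens _ _ _) _.
    apply: le_trans (hdens_le_ldens _ _ _ l0) _.
    by rewrite -(pmulr_rle0 _ (mu_gt0 x)) N0; exact: ldens_le_normlam.
  by split; apply/funext => x; have /eqP := uv0 x;
    rewrite paddr_eq0 ?sqr_ge0// !sqrf_eq0 => /andP[/eqP ? /eqP ?].
set K := Num.sqrt (N / m).
have NK : N <= K `^ (p - 2) * N.
  rewrite -lee_fin {1}NB -(vint_nonlinE l0 uH) EFinM -(Hlamnorm2E l0 uH).
  rewrite -vintZ ?powR_ge0//; last by move=> x; exact: ldens_ge0.
  apply: le_vint => x; apply: le_trans (nonlin_le_sup x l0 uH) _.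
  rewrite ler_wpM2l ?powR_ge0//; apply: le_trans (sqr_le_hdens _ _ _) _.
  exact: hdens_le_ldens.
rewrite leNgt; apply/negP => Nm; move: NK; rewrite leNgt => /negP; apply.
rewrite -[X in _ < X]mul1r ltr_pM2r//.
have one_pow : (1 : R) `^ (p - 2) = 1 by rewrite powR1.
rewrite -[X in _ < X]one_pow.
have := p_gt2; move=> p2.
apply: gt0_ltr_powR; rewrite ?nnegrE ?sqrtr_ge0//; first lra.
by rewrite -[X in _ < X]sqrtr1 ltr_sqrt// ltr_pdivrMr// mul1r.
Qed.

(** * The Dirichlet system *)

Variable s : seq V.
Hypothesis s_uniq : uniq s.
Hypothesis s_supp : forall x,
  closure_g nb (Oma a) x \/ closure_g nb (Omb b) x -> x \in s.

(** The list [s] contains the closures of both domains, because the gradient of a function supported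
    in a domain also lives on its boundary. On H_Omega all integrals are then finite sums over
    [s]. *)
Definition normOm (u v : V -> R) : R := \sum_(x <- s) mu x * hdens u v x.

Definition nlOm (u v : V -> R) : R :=
  \sum_(x <- s) mu x * nonlin alpha beta u v x.

Lemma normOm_ge0 u v : 0 <= normOm u v.
Proof. by apply: sumr_ge0 => x _; rewrite mulr_ge0 ?hdens_ge0. Qed.

Lemma potential_out x : x \notin s -> a x <> 0 /\ b x <> 0.
Proof.
by move=> /negP xs; split=> ab0; apply: xs; apply: s_supp; [left|right]; left.
Qed.

Lemma HOm_out u v x : HOm a b u v -> x \notin s ->
  [/\ u x = 0, v x = 0 & forall y, y \in nb x -> u y = 0 /\ v y = 0].
Proof.
have [[_ symG] _ _ _ _] := hG.
move=> [uA vB] /negP xs; split.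
- by apply: uA => xA; apply: xs; apply: s_supp; left; left.
- by apply: vB => xA; apply: xs; apply: s_supp; right; left.
- move=> y yx; split.
    apply: uA => yA; apply: xs; apply: s_supp; left; right.
    by exists y => //; rewrite -symG.
  apply: vB => yA; apply: xs; apply: s_supp; right; right.
  by exists y => //; rewrite -symG.
Qed.

(** Off [s] the pair [(u, v)] vanishes at the vertex and at all its neighbours, so subtracting it
    changes no difference entering the gradient. *)
Lemma hdensB_out u v u' v' x : HOm a b u v -> x \notin s ->
  hdens (fun y => u' y - u y) (fun y => v' y - v y) x = hdens u' v' x.
Proof.
move=> uH xs; have [ux vx nbx] := HOm_out uH xs.
have gradB (f g : V -> R) : f x = 0 -> (forall y, y \in nb x -> f y = 0) ->
    grad2 nb w mu (fun y => g y - f y) x = grad2 nb w mu g x.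
  move=> fx fy; congr (_ * _); apply: eq_big_seq => y yx.
  by rewrite fx fy// !subr0.
rewrite /hdens !gradB ?ux ?vx ?subr0//.
- by move=> y /nbx[].
- by move=> y /nbx[].
Qed.

Lemma hdens_out u v x : HOm a b u v -> x \notin s -> hdens u v x = 0.
Proof.
(* Subtracting the pair from itself leaves its density unchanged off [s], and yet gives zero. *)
move=> uH xs; rewrite -(hdensB_out u v uH xs) /hdens /grad2 !subrr !expr0n/=.
rewrite !big1 ?mulr0 ?addr0// => y _; by rewrite !subrr expr0n mulr0.
Qed.

Lemma nonlin_out u v x : HOm a b u v -> x \notin s ->
  nonlin alpha beta u v x = 0.
Proof.
move=> uH xs; have [ux _ _] := HOm_out uH xs.
by rewrite /nonlin ux normr0 powR0 ?mul0r// gt_eqF//; have := alpha_gt1; lra.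
Qed.

(** At each vertex either the potential or the function it multiplies is zero. *)
Lemma ldens_HOm l u v : HOm a b u v -> ldens l u v = hdens u v.
Proof.
move=> [uA vB]; apply/funext => x; rewrite ldensE.
have -> : l * a x * u x ^+ 2 = 0.
  have [->|/eqP/uA ->] := eqVneq (a x) 0; first by rewrite mulr0 mul0r.
  by rewrite expr0n mulr0.
have -> : l * b x * v x ^+ 2 = 0.
  have [->|/eqP/vB ->] := eqVneq (b x) 0; first by rewrite mulr0 mul0r.
  by rewrite expr0n mulr0.
by rewrite !addr0.
Qed.

Lemma vint_hdens u v : HOm a b u v -> vint mu setT (hdens u v) = (normOm u v)%:E.
Proof.
move=> uH; apply: vint_seq => // x; first exact: hdens_ge0.
exact: hdens_out.
Qed.

Lemma vint_nonlin u v : HOm a b u v ->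
  vint mu setT (nonlin alpha beta u v) = (nlOm u v)%:E.
Proof.
move=> uH; apply: vint_seq => // x; first exact: nonlin_ge0.
exact: nonlin_out.
Qed.

Lemma JOmE u v : HOm a b u v ->
  JOm nb w mu alpha beta a b u v = normOm u v / 2 - nlOm u v / p.
Proof.
move=> uH; have [uA vB] := uH.
have p0 : alpha != 0 /\ beta != 0.
  by have := alpha_gt1; have := beta_gt1 => *; split; rewrite gt_eqF//; lra.
(* Each integrand vanishes off its domain of integration, so all three integrals extend to [V]; the
   two quadratic ones then merge into that of [hdens]. *)
rewrite /JOm !vint_supp; last first.
- move=> x /not_orP[xA xB]; apply/eqP.
  rewrite addr_eq0 (grad2_out uA)// (grad2_out vB)//; exact/eqP/esym/oppr0.
- by move=> x /not_orP[xA xB]; rewrite uA// vB// expr0n addr0.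
- by move=> x /not_orP[xA xB]; rewrite /nonlin uA// normr0 powR0 ?p0.1// mul0r.
have g0 : (0 <= vint mu setT (fun x => (grad2 nb w mu u x + grad2 nb w mu v x)%R))%E.
  by apply: vint_ge0 => x; rewrite addr_ge0 ?grad2_ge0.
have q0 : (0 <= vint mu setT (fun x => (u x ^+ 2 + v x ^+ 2)%R))%E.
  by apply: vint_ge0 => x; rewrite addr_ge0 ?sqr_ge0.
have := vint_hdens uH.
have -> : hdens u v = (fun x => (grad2 nb w mu u x + grad2 nb w mu v x) +
                                (u x ^+ 2 + v x ^+ 2)).
  by apply/funext => x; rewrite /hdens addrA.
rewrite vintD; last 2 first.
- by move=> x; rewrite addr_ge0 ?grad2_ge0.
- by move=> x; rewrite addr_ge0 ?sqr_ge0.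
rewrite vint_nonlin//.
(* Non-negative extended reals with a finite sum are finite, so [fine] is additive here. *)
by case: (vint _ _ _) g0 => [r| |]//; case: (vint _ _ _) q0 => [r'| |]//= _ _
  [<-]; rewrite mulrDl.
Qed.

Lemma HOm_inHlam l u v : HOm a b u v -> inHlam nb w mu a b l u v.
Proof.
move=> uH; split; first by rewrite /inH [X in (X < _)%E]vint_hdens// ltry.
rewrite /vint esum1 ?ltry// => x _.
have := congr1 (fun f => f x) (ldens_HOm l uH); rewrite /= ldensE.
by move/eqP; rewrite -subr_eq0 addrAC subrr add0r => /eqP ->; rewrite mulr0.
Qed.

Lemma Jlam_HOm l u v : HOm a b u v ->
  Jlam nb w mu alpha beta a b l u v = JOm nb w mu alpha beta a b u v.
Proof.
move=> uH; rewrite JOmE// /Jlam vint_nonlin//.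
have -> : Hlamnorm2 nb w mu a b l u v = vint mu setT (ldens l u v) by [].
by rewrite ldens_HOm// vint_hdens.
Qed.

Lemma HOm_line u v f g k : HOm a b u v -> HOm a b f g ->
  HOm a b (fun x => u x + k * f x) (fun x => v x + k * g x).
Proof.
by move=> [uA vB] [fA gB]; split=> x xP; rewrite ?uA ?vB ?fA ?gB// mulr0 addr0.
Qed.

Lemma HOmZ u v k : HOm a b u v -> HOm a b (fun x => k * u x) (fun x => k * v x).
Proof. by move=> [uA vB]; split=> x xP; rewrite ?uA ?vB// mulr0. Qed.

Lemma normOmZ u v k :
  normOm (fun x => k * u x) (fun x => k * v x) = k ^+ 2 * normOm u v.
Proof.
by rewrite /normOm mulr_sumr; apply: eq_bigr => x _; rewrite hdensZ mulrCA.
Qed.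

Lemma normOm0 : normOm (fun=> 0) (fun=> 0) = 0.
Proof. by have := normOmZ (fun=> 0) (fun=> 0) 0; rewrite expr0n !mul0r. Qed.

Lemma nlOmZ u v k :
  nlOm (fun x => k * u x) (fun x => k * v x) = `|k| `^ p * nlOm u v.
Proof.
by rewrite /nlOm mulr_sumr; apply: eq_bigr => x _; rewrite nonlinZ mulrCA.
Qed.

Lemma dJ0_JOm u v : HOm a b u v ->
  dJ0 (JOm nb w mu alpha beta a b) u v u v <-> normOm u v = nlOm u v.
Proof.
move=> uH; have p1 : 1 < p by have := p_gt2; lra.
apply: (dJ0_ray p1) => k; rewrite JOmE; last exact: HOmZ.
by rewrite normOmZ nlOmZ.
Qed.

(** The ray stays in H_Omega, where [Jlam] and [JOm] agree, so the derivatives along it coincide. *)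
Lemma nehari_Om_lam l u v :
  nehari (JOm nb w mu alpha beta a b) (HOm a b) u v ->
  nehari (Jlam nb w mu alpha beta a b l) (inHlam nb w mu a b l) u v.
Proof.
move=> [uH u0 dJ]; split=> //; first exact: HOm_inHlam.
move: dJ; rewrite /dJ0 (_ : Jline _ _ _ _ _ =
  Jline (Jlam nb w mu alpha beta a b l) u v u v)//.
by apply/funext => t; rewrite /Jline Jlam_HOm//; exact: HOm_line.
Qed.

Lemma energy_fac_gt0 : 0 < 2^-1 - p^-1.
Proof.
have p2 := p_gt2; rewrite subr_gt0 ltf_pV2// posrE; lra.
Qed.

Lemma JOm_nehari u v : nehari (JOm nb w mu alpha beta a b) (HOm a b) u v ->
  JOm nb w mu alpha beta a b u v = (2^-1 - p^-1) * normOm u v.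
Proof.
move=> [uH _ dJ]; have [/(_ dJ) NB _] := dJ0_JOm uH.
rewrite JOmE// -NB; ring.
Qed.

Lemma Jlam_nehari l u v : 0 <= l ->
  nehari (Jlam nb w mu alpha beta a b l) (inHlam nb w mu a b l) u v ->
  Jlam nb w mu alpha beta a b l u v = (2^-1 - p^-1) * normlam l u v.
Proof.
move=> l0 uN; have := nehari_lamE l0 uN.
rewrite /Jlam /normlam /intnl => <-; ring.
Qed.

(** A Dirichlet Nehari pair competes in the infimum for each [l], and on both Nehari sets the energy
    is the same multiple of the norm. *)
Lemma ground_state_le l u v z1 z2 : 0 <= l ->
  ground_state (Jlam nb w mu alpha beta a b l) (inHlam nb w mu a b l) u v ->
  nehari (JOm nb w mu alpha beta a b) (HOm a b) z1 z2 ->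
  normlam l u v <= normOm z1 z2.
Proof.
move=> l0 [_ uN JE] zN; rewrite -(ler_pM2l energy_fac_gt0).
rewrite -(Jlam_nehari l0 uN) -(JOm_nehari zN).
have [zH _ _] := zN; rewrite -(Jlam_HOm l zH).
suff : (c_nehari (Jlam nb w mu alpha beta a b l) (inHlam nb w mu a b l) <=
    (Jlam nb w mu alpha beta a b l z1 z2)%:E)%E by rewrite -JE lee_fin.
rewrite /c_nehari; apply: ereal_inf_lbound.
exists (z1, z2); last by reflexivity.
rewrite /=.
exact: nehari_Om_lam zN.
Qed.

Lemma normOm_gt0 u v : 0 < nlOm u v -> 0 < normOm u v.
Proof.
move=> B0; rewrite lt_neqAle normOm_ge0 andbT eq_sym.
apply: contraTN B0 => /eqP N0; rewrite -leNgt.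
suff -> : nlOm u v = 0 by [].
apply: big1_seq => x /andP[_ xs].
have /eqP : mu x * hdens u v x == 0.
  move/eqP: N0; rewrite /normOm psumr_eq0; last first.
    by move=> y _; rewrite mulr_ge0 ?hdens_ge0.
  by move=> /allP/(_ x xs).
move=> /eqP; rewrite mulf_eq0 gt_eqF//= => /eqP h0.
have := sqr_le_hdens u v x; rewrite h0 => uv0.
have /eqP : u x ^+ 2 = 0 by have := sqr_ge0 (u x); have := sqr_ge0 (v x); lra.
rewrite sqrf_eq0 => /eqP ux; rewrite /nonlin ux normr0 powR0 ?mul0r ?mulr0//.
by rewrite gt_eqF//; have := alpha_gt1; lra.
Qed.

(** The factor solves t^2 N = t^p B. The value of t^(p-2) is part of the conclusion because it later
    gives ln t and the bound t <= 1. *)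
Lemma nehari_proj u v : HOm a b u v -> 0 < nlOm u v ->
  exists t : R, [/\ 0 < t, t `^ (p - 2) = normOm u v / nlOm u v &
    nehari (JOm nb w mu alpha beta a b) (HOm a b)
      (fun x => t * u x) (fun x => t * v x)].
Proof.
move=> uH B0; have N0 := normOm_gt0 B0; have p2 := p_gt2.
have pB0 : p - 2 != 0 by rewrite gt_eqF//; lra.
pose t := (normOm u v / nlOm u v) `^ (p - 2)^-1.
have t0 : 0 < t by rewrite powR_gt0// divr_gt0.
have tE : t `^ (p - 2) = normOm u v / nlOm u v.
  by rewrite -powRrM mulVf// powRr1// divr_ge0// ltW.
exists t; split=> //; split; first exact: HOmZ.
- move=> [tu0 tv0]; move: (normOmZ u v t).
  rewrite tu0 tv0 normOm0.
  by move/esym/eqP; rewrite mulf_eq0 sqrf_eq0 (gt_eqF t0) (gt_eqF N0).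
- apply/dJ0_JOm; first exact: HOmZ.
  rewrite normOmZ nlOmZ gtr0_norm// -[X in t `^ X](subrK 2).
  rewrite (@powRD _ t); last by apply/implyP => _; rewrite gt_eqF.
  rewrite powR_mulrn ?ltW// tE [in RHS]mulrAC divfK ?gt_eqF//; ring.
Qed.

Lemma nehari_Om_exists : exists z : (V -> R) * (V -> R),
  nehari (JOm nb w mu alpha beta a b) (HOm a b) z.1 z.2.
Proof.
have [_ _ _ _ [[x0 [ax0 bx0]] _]] := hA1.
(* The indicator of a common zero of [a] and [b] belongs to both factors of H_Omega and makes the
   coupling term positive. *)
pose d (x : V) : R := (x == x0)%:R.
have dH : HOm a b d d.
  by split=> x xA; rewrite /d; case: eqVneq => // xx0; case: xA; rewrite xx0.
have x0s : x0 \in s by apply: s_supp; left; left.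
have [|t [_ _ tN]] := @nehari_proj d d dH; last by eexists (_, _); exact: tN.
rewrite /nlOm (big_rem x0)//=; apply: ltr_pwDl.
  by rewrite mulr_gt0// /nonlin /d eqxx normr1 !powR1 mulr1.
by apply: sumr_ge0 => x _; rewrite mulr_ge0 ?nonlin_ge0.
Qed.

(** * Criticality of Nehari minimizers *)

Lemma derivable_line (c d t : R) : derivable (fun r : R => c + r * d) t 1.
Proof.
have -> : (fun r : R => c + r * d) = cst c + d *: id.
  by apply/funext => r; rewrite !fctE /GRing.scale/= mulrC.
by apply: derivableD; [exact: derivable_cst|apply: derivableZ].
Qed.

Lemma derivable_normOm_line u v f g t :
  derivable (fun r : R => normOm (fun x => u x + r * f x)
                                 (fun x => v x + r * g x)) t 1.
Proof.
have dgrad (u' f' : V -> R) x :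
    derivable (fun r : R => grad2 nb w mu (fun y => u' y + r * f' y) x) t 1.
  apply: derivable_fun_mulc; apply: derivable_bigsum => y.
  apply: derivable_fun_mulc; apply: derivable_fun_sqr.
  by apply: derivable_fun_sub; exact: derivable_line.
apply: derivable_bigsum => x; apply: derivable_fun_mulc.
apply: derivable_fun_add; last by apply: derivable_fun_sqr; exact: derivable_line.
apply: derivable_fun_add; last by apply: derivable_fun_sqr; exact: derivable_line.
by apply: derivable_fun_add; exact: dgrad.
Qed.

Lemma derivable_nlOm_line u v f g t :
  derivable (fun r : R => nlOm (fun x => u x + r * f x)
                               (fun x => v x + r * g x)) t 1.
Proof.
apply: derivable_bigsum => x; apply: derivable_fun_mulc.
apply: derivable_fun_mul.
  apply: (@derivable_comp _ (fun y : R => `|y| `^ alpha)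
            (fun r : R => u x + r * f x)); last exact: derivable_line.
  exact: derivable_norm_powR.
apply: (@derivable_comp _ (fun y : R => `|y| `^ beta)
          (fun r : R => v x + r * g x)); last exact: derivable_line.
exact: derivable_norm_powR.
Qed.

(* A minimizer on the Nehari set minimizes the scale-invariant quotient
   [normOm ^ p / nlOm ^ 2] among all directions, so no Lagrange multiplier
   appears. *)
Lemma nehari_min_critical u v :
  nehari (JOm nb w mu alpha beta a b) (HOm a b) u v ->
  (forall z1 z2, nehari (JOm nb w mu alpha beta a b) (HOm a b) z1 z2 ->
     normOm u v <= normOm z1 z2) ->
  0 < normOm u v ->
  critical (JOm nb w mu alpha beta a b) (HOm a b) u v.
Proof.
move=> [uH _ dJ] umin N0; have [/(_ dJ) NB _] := dJ0_JOm uH.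
split; first exact: uH.
move=> f g fH; have p2 := p_gt2.
pose n t := normOm (fun x => u x + t * f x) (fun x => v x + t * g x).
pose c t := nlOm (fun x => u x + t * f x) (fun x => v x + t * g x).
have line0 (f' g' : V -> R) : (fun x => f' x + 0 * g' x) = f'.
  by apply/funext => x; rewrite mul0r addr0.
have n0E : n 0 = normOm u v by rewrite /n !line0.
have c0E : c 0 = nlOm u v by rewrite /c !line0.
have [der val] : is_derive (0 : R) (1 : R) (fun t => n t / 2 - c t / p) 0.
  apply: is_derive_energy_min => //.
  - by move=> t; exact: derivable_normOm_line.
  - by move=> t; exact: derivable_nlOm_line.
  - by rewrite n0E.
  - by rewrite n0E c0E.
  - move=> t nt ct; rewrite n0E.
    (* The perturbed pair is rescaled to the Nehari set, where minimality gives N <= tau^2 n(t). As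
       tau^(p-2) = n(t) / c(t), taking logarithms and multiplying by p - 2 gives the required
       inequality. *)
    have [tau [tau0 tauE tauN]] := nehari_proj (HOm_line t uH fH) ct.
    have := umin _ _ tauN; rewrite normOmZ -/(n t) => le_n.
    have lntau : (p - 2) * ln tau = ln (n t) - ln (c t).
      by rewrite -ln_powR tauE ln_div.
    have : ln (normOm u v) <= 2 * ln tau + ln (n t).
      have -> : 2 * ln tau + ln (n t) = ln (tau ^+ 2 * n t).
        by rewrite lnM ?posrE ?exprn_gt0// lnXn// mulr_natl.
      by rewrite ler_ln ?posrE// mulr_gt0 ?exprn_gt0.
    move=> /(ler_wpM2l (ltW (_ : 0 < p - 2))); rewrite subr_gt0 => /(_ p2).
    move=> /le_trans; apply.
    rewrite mulrDr mulrCA lntau; lra.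
have JlineE : Jline (JOm nb w mu alpha beta a b) u v f g =
    (fun t => n t / 2 - c t / p).
  by apply/funext => t; rewrite /Jline JOmE//; exact: HOm_line.
by rewrite /dJ0 JlineE derive1E.
Qed.

(** * Passage to the limit *)

Section Limit.
Variables (l : nat -> R) (un vn : nat -> V -> R) (u v : V -> R) (L : R).
Hypotheses (l_gt0 : forall n, 0 < l n) (l_cvg : l n @[n --> \oo] --> +oo).
Hypothesis un_gs : forall n, ground_state (Jlam nb w mu alpha beta a b (l n))
  (inHlam nb w mu a b (l n)) (un n) (vn n).
Hypothesis un_cvg : forall x, un n x @[n --> \oo] --> u x.
Hypothesis vn_cvg : forall x, vn n x @[n --> \oo] --> v x.
Hypothesis norm_cvg : normlam (l n) (un n) (vn n) @[n --> \oo] --> L.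
Hypothesis uv_HOm : HOm a b u v.

Let l_ge0 n : 0 <= l n. Proof. exact: ltW. Qed.

Let unN n : nehari (Jlam nb w mu alpha beta a b (l n))
  (inHlam nb w mu a b (l n)) (un n) (vn n).
Proof. by have [] := un_gs n. Qed.

Let unH n : inHlam nb w mu a b (l n) (un n) (vn n).
Proof. by have [] := unN n. Qed.

Lemma cvg_grad2 (f : nat -> V -> R) (g : V -> R) x :
  (forall y, f n y @[n --> \oo] --> g y) ->
  grad2 nb w mu (f n) x @[n --> \oo] --> grad2 nb w mu g x.
Proof.
move=> fg; apply: cvgM; first exact: cvg_cst.
apply: cvg_bigsum => y _; apply: cvgM; first exact: cvg_cst.
by rewrite expr2; under eq_fun do rewrite expr2; apply: cvgM; apply: cvgB.
Qed.

Lemma cvg_hdens (f f' : nat -> V -> R) (g g' : V -> R) x :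
  (forall y, f n y @[n --> \oo] --> g y) ->
  (forall y, f' n y @[n --> \oo] --> g' y) ->
  hdens (f n) (f' n) x @[n --> \oo] --> hdens g g' x.
Proof.
move=> fg fg'; apply: cvgD; [apply: cvgD; [apply: cvgD|]|].
- exact: cvg_grad2.
- exact: cvg_grad2.
- by rewrite expr2; under eq_fun do rewrite expr2; apply: cvgM.
- by rewrite expr2; under eq_fun do rewrite expr2; apply: cvgM.
Qed.

Lemma cvg_normOm (f f' : nat -> V -> R) (g g' : V -> R) :
  (forall y, f n y @[n --> \oo] --> g y) ->
  (forall y, f' n y @[n --> \oo] --> g' y) ->
  normOm (f n) (f' n) @[n --> \oo] --> normOm g g'.
Proof.
move=> fg fg'; apply: cvg_bigsum => x _; apply: cvgM; first exact: cvg_cst.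
exact: cvg_hdens.
Qed.

Lemma cvg_nlOm : nlOm (un n) (vn n) @[n --> \oo] --> nlOm u v.
Proof.
apply: cvg_bigsum => x _; apply: cvgM; first exact: cvg_cst.
have cvg_pow (r c : R) (f : nat -> R) : 1 < r -> f n @[n --> \oo] --> c ->
    `|f n| `^ r @[n --> \oo] --> `|c| `^ r.
  move=> r1 fc; have := derivable_continuous (@derivable_norm_powR _ _ c r1).
  by move=> ch; exact: (cvg_comp f _ fc ch).
by apply: cvgM; exact: cvg_pow.
Qed.

(** An elementary Fatou argument: the sums over [s] lie below the full norms and converge. *)
Lemma normOm_le_L : normOm u v <= L.
Proof.
apply: ler_cvg_to (cvg_normOm un_cvg vn_cvg) norm_cvg _; near=> n.
apply: le_trans (sum_le_normlam (l_ge0 n) (unH n) s_uniq).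
by apply: ler_sum => x _; rewrite ler_wpM2l ?hdens_le_ldens.
Unshelve. all: by end_near. Qed.

Lemma L_le_nehari z1 z2 : nehari (JOm nb w mu alpha beta a b) (HOm a b) z1 z2 ->
  L <= normOm z1 z2.
Proof.
move=> zN; apply: (cvgr_to_le norm_cvg); near=> n.
exact: ground_state_le (un_gs n) zN.
Unshelve. all: by end_near. Qed.

(** This excludes a vanishing limit. *)
Lemma L_ge : m <= L.
Proof.
apply: (cvgr_to_ge norm_cvg); near=> n; exact: normlam_ge.
Unshelve. all: by end_near. Qed.

(* Off [s] the potentials bound [u^2 + v^2] by [ldens / (l e)], so the
   nonlinear term carries no mass there in the limit. *)
Lemma L_le_nlOm : L <= nlOm u v.
Proof.
have [e e0 eP] := potential_gap.
have [[z1 z2] /= zN] := nehari_Om_exists.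
set M := normOm z1 z2.
have leM n : normlam (l n) (un n) (vn n) <= M by exact: ground_state_le zN.
have M0 : 0 < M.
  by apply: lt_le_trans (leM 0); exact: lt_le_trans (normlam_ge _ (unN 0)).
(* Since [M] bounds all the norms, [K] bounds the factor in [nonlin_le_sup] uniformly in [n]. *)
pose K := Num.sqrt (M / m) `^ (p - 2).
have K0 : 0 <= K by exact: powR_ge0.
have le_n n : normlam (l n) (un n) (vn n) <=
    nlOm (un n) (vn n) + K * M / e * (l n)^-1.
  have le0 : 0 < l n * e by rewrite mulr_gt0.
  have Kle0 : 0 <= K / (l n * e) by rewrite divr_ge0// ltW.
  rewrite {1}(nehari_lamE (l_ge0 n) (unN n)).
  apply: (@le_trans _ _ (nlOm (un n) (vn n) +
                         K / (l n * e) * normlam (l n) (un n) (vn n))); last first.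
    have -> : K * M / e / l n = K / (l n * e) * M by rewrite invfM; ring.
    by rewrite lerD2l ler_wpM2l.
  rewrite -lee_fin -(vint_nonlinE (l_ge0 n) (unH n)) EFinD EFinM.
  rewrite -(Hlamnorm2E (l_ge0 n) (unH n)) -vintZ//; last first.
    by move=> x; exact: ldens_ge0.
  (* The finite sum becomes the integral over [V] of the nonlinear term cut off to [s], which
     reduces the estimate to a pointwise one. *)
  have -> : nlOm (un n) (vn n) = \sum_(x <- s) mu x *
      (if x \in s then nonlin alpha beta (un n) (vn n) x else 0).
    by apply: eq_big_seq => x ->.
  rewrite -vint_seq//; last 2 first.
  - by move=> x; case: ifP => // _; exact: nonlin_ge0.
  - by move=> x /negPf ->.
  rewrite -vintD; last 2 first.
  - by move=> x; case: ifP => // _; exact: nonlin_ge0.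
  - by move=> x; rewrite mulr_ge0 ?ldens_ge0.
  apply: le_vint => x; case: ifPn => [_|xs].
    by rewrite lerDl mulr_ge0 ?ldens_ge0.
  rewrite add0r; apply: le_trans (nonlin_le_sup x (l_ge0 n) (unH n)) _.
  rewrite -mulrA; apply: ler_pM; rewrite ?powR_ge0 ?addr_ge0 ?sqr_ge0//.
    apply: ge0_ler_powR; rewrite ?nnegrE ?sqrtr_ge0//.
      by have := p_gt2; lra.
    by rewrite ler_wsqrtr// ler_wpM2r// invr_ge0 ltW.
  rewrite ler_pdivlMl// -[leRHS]/(ldens (l n) (un n) (vn n) x) ldensE.
  have [ax bx] := potential_out xs.
  have /(_ ax) ea := (eP x).1; have /(_ bx) eb := (eP x).2.
  apply: le_trans (_ : l n * a x * un n x ^+ 2 + l n * b x * vn n x ^+ 2 <= _).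
    by rewrite mulrDr lerD// ler_wpM2r ?sqr_ge0// ler_wpM2l.
  by rewrite lerDr hdens_ge0.
have inv_cvg : (l n)^-1 @[n --> \oo] --> (0 : R).
  by apply/gtr0_cvgV0; [near=> n; exact: l_gt0|exact: l_cvg].
have up_cvg : nlOm (un n) (vn n) + K * M / e * (l n)^-1 @[n --> \oo] -->
    nlOm u v + K * M / e * 0.
  apply: cvgD; first exact: cvg_nlOm.
  by apply: cvgM inv_cvg; exact: cvg_cst.
rewrite mulr0 addr0 in up_cvg.
by apply: (ler_cvg_to norm_cvg up_cvg); near=> n; exact: le_n.
Unshelve. all: by end_near. Qed.

Lemma limit_nehari_norm : normOm u v = L /\ nlOm u v = L.
Proof.
have L0 : 0 < L by exact: lt_le_trans L_ge.
have B0 : 0 < nlOm u v by exact: lt_le_trans L_le_nlOm.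
have N0 := normOm_gt0 B0; have p2 := p_gt2.
have [t [t0 tE /L_le_nehari]] := nehari_proj uv_HOm B0.
rewrite normOmZ => Lt.
have t1 : t <= 1.
  rewrite leNgt; apply/negP => t1.
  have : 1 < t `^ (p - 2).
    have one_pow : (1 : R) `^ (p - 2) = 1 by rewrite powR1.
    rewrite -[X in X < _]one_pow.
    by apply: gt0_ltr_powR; rewrite ?nnegrE ?subr_gt0// ltW.
  rewrite tE ltr_pdivlMr// mul1r ltNge => /negP; apply.
  exact: le_trans normOm_le_L L_le_nlOm.
have NL : normOm u v = L.
  apply/eqP; rewrite eq_le normOm_le_L/=; apply: le_trans Lt _.
  by rewrite ger_pMl// expr_le1// ltW.
have t1' : t = 1.
  apply/eqP; rewrite eq_le t1/= leNgt; apply/negP => tlt.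
  move: Lt; rewrite NL leNgt => /negP; apply.
  by rewrite gtr_pMl// expr_lt1// ltW.
split=> //; rewrite -NL; move: tE; rewrite t1' powR1.
by move=> /(congr1 (fun z => z * nlOm u v)); rewrite mul1r divfK ?gt_eqF.
Qed.

Lemma limit_ground_state :
  ground_state (JOm nb w mu alpha beta a b) (HOm a b) u v.
Proof.
have [NL BL] := limit_nehari_norm.
have N0 : 0 < normOm u v by rewrite NL; exact: lt_le_trans L_ge.
have uN : nehari (JOm nb w mu alpha beta a b) (HOm a b) u v.
  split=> //; last by apply/dJ0_JOm; rewrite ?NL.
  by move=> [u0 v0]; move: N0; rewrite u0 v0 normOm0 ltxx.
split=> //.
  apply: nehari_min_critical => // z1 z2; rewrite NL; exact: L_le_nehari.
apply/eqP; rewrite eq_le; apply/andP; split.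
  apply: le_ereal_inf_tmp => _ [[z1 z2] /= zN <-].
  rewrite lee_fin (JOm_nehari uN) (JOm_nehari zN) ler_pM2l ?energy_fac_gt0//.
  by rewrite NL; exact: L_le_nehari.
by rewrite /c_nehari; apply: ereal_inf_lbound; exists (u, v).
Qed.

Lemma limit_strong : Hnorm2 nb w mu (fun x => un n x - u x)
  (fun x => vn n x - v x) @[n --> \oo] --> 0%E.
Proof.
have [NL _] := limit_nehari_norm.
(* Off [s] the difference has the density of [(un n, vn n)], so its squared H norm is that of
   [(un n, vn n)] with the part on [s] exchanged, hence at most [r n]. The limit of [r] is L + 0 -
   L. *)
pose r n := normlam (l n) (un n) (vn n) +
  normOm (fun x => un n x - u x) (fun x => vn n x - v x) - normOm (un n) (vn n).
have rcvg : r n @[n --> \oo] --> (0 : R).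
  have diff_cvg : normOm (fun x => un n x - u x) (fun x => vn n x - v x)
      @[n --> \oo] --> (0 : R).
    rewrite -[X in _ --> X]normOm0.
    apply: cvg_normOm => y; apply/subr_cvg0; [exact: un_cvg|exact: vn_cvg].
  have -> : (0 : R) = L + 0 - normOm u v by rewrite NL addr0 subrr.
  apply: cvgB; last exact: cvg_normOm.
  by apply: cvgD.
apply: (@squeeze_cvge _ _ _ _ (cst 0%E) _ (fun n => (r n)%:E)).
- near=> n; apply/andP; split; first by apply: vint_ge0 => x; exact: hdens_ge0.
  have := @vint_modify s (hdens (fun x => un n x - u x) (fun x => vn n x - v x))
    (hdens (un n) (vn n)) s_uniq (hdens_ge0 _ _) (hdens_ge0 _ _)
    (fun x xs => hdensB_out (un n) (vn n) uv_HOm xs).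
  rewrite -/(normOm _ _) -/(normOm _ _) => E.
  rewrite /r EFinB leeBrDr//; rewrite [X in (X <= _)%E]E EFinD leeD2r//.
  rewrite -Hlamnorm2E//; apply: le_vint => x; exact: hdens_le_ldens.
- exact: cvg_cst.
- by apply: cvg_EFin rcvg; near=> n.
Unshelve. all: by end_near. Qed.

End Limit.
End System.
End Graph.

(** * Extraction of the subsequence and conclusion *)

Theorem theorem1p3 (R : realType) (V : choiceType)
  (nb : V -> seq V) (w : V -> V -> R) (mu : V -> R)
  (alpha beta : R) (a b : V -> R)
  (uv : R -> (V -> R) * (V -> R)) (lam : nat -> R) :
  graph_setting nb w mu -> 1 < alpha -> 1 < beta ->
  A1 nb a b -> A2 nb a b ->
  (forall l : R, 0 < l ->
     ground_state (Jlam nb w mu alpha beta a b l) (inHlam nb w mu a b l)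
                  (uv l).1 (uv l).2) ->
  lam n @[n --> \oo] --> +oo ->
  exists (sigma : nat -> nat) (u v : V -> R),
    [/\ (forall n, (sigma n < sigma n.+1)%N) /\
        Hnorm2 nb w mu (fun x => (uv (lam (sigma n))).1 x - u x)
                       (fun x => (uv (lam (sigma n))).2 x - v x) @[n --> \oo] --> 0%E,
        (forall x, a x <> 0 -> u x = 0),
        (forall x, b x <> 0 -> v x = 0),
        HOm a b u v &
        ground_state (JOm nb w mu alpha beta a b) (HOm a b) u v].
Proof.
move=> hG alpha1 beta1 hA1 hA2 gs lcvg.
have [_ _ _ _ [m [m0 mle]]] := hG.
have [_ _ [_ /(closure_g_seq (nb := nb))[sa saP]]
          [_ /(closure_g_seq (nb := nb))[sb sbP]] _] := hA1.
pose s := undup (sa ++ sb).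
have s_uniq : uniq s by exact: undup_uniq.
have s_supp x : closure_g nb (Oma a) x \/ closure_g nb (Omb b) x -> x \in s.
  by rewrite mem_undup mem_cat => -[/saP ->|/sbP ->]; rewrite ?orbT.
(* The given sequence is positive only eventually, so its first [N0] terms are skipped. *)
have [N0 _ lam_gt0] := cvgry_gt lcvg 0.
pose l n := lam (N0 + n)%N.
have l_gt0 n : 0 < l n by apply: lam_gt0; rewrite /= leq_addr.
have l_gs n := gs _ (l_gt0 n).
have l_in n : inHlam nb w mu a b (l n) (uv (l n)).1 (uv (l n)).2.
  by have [_ []] := l_gs n.
have [[z1 z2] /= zN] :=
  nehari_Om_exists (w := w) hG alpha1 beta1 hA1 s_uniq s_supp.
set M := normOm nb w mu s z1 z2 in zN.
pose N n := normlam nb w mu a b (l n) (uv (l n)).1 (uv (l n)).2.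
have N_le n : N n <= M.
  exact: (ground_state_le hG alpha1 beta1 hA1 s_uniq s_supp (ltW (l_gt0 n))).
pose K := Num.sqrt (M / m).
have sup_le n x : `|(uv (l n)).1 x| <= K /\ `|(uv (l n)).2 x| <= K.
  have [ux vx] := sup_le_normlam hG hA1 m0 mle x (ltW (l_gt0 n)) (l_in n).
  have NK : Num.sqrt (N n / m) <= K.
    by rewrite ler_wsqrtr// ler_wpM2r// invr_ge0 ltW.
  by split; [exact: le_trans ux NK|exact: le_trans vx NK].
have N_ge0 n : 0 <= N n.
  by apply: le_trans (ltW m0) (normlam_ge hG alpha1 beta1 hA1 m0 mle
    (ltW (l_gt0 n)) _); have [] := l_gs n.
(* Both components at every vertex and the norms form one bounded family, so that a single
   extraction serves all of them. *)
pose F (i : V + V + unit) n : R := match i with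
  | inl (inl x) => (uv (l n)).1 x
  | inl (inr x) => (uv (l n)).2 x
  | inr _ => N n
  end.
have F_le i n : `|F i n| <= K + M.
  have K0 : 0 <= K by exact: sqrtr_ge0.
  have M0 : 0 <= M by exact: le_trans (N_ge0 0) (N_le 0).
  case: i => [[x|x]|_] /=.
  - by apply: le_trans (sup_le n x).1 _; rewrite lerDl.
  - by apply: le_trans (sup_le n x).2 _; rewrite lerDl.
  - by rewrite ger0_norm//; apply: le_trans (N_le n) _; rewrite lerDr.
have [t t_incr tP] := bolzano_weierstrass_family
  (inr tt :: map (inl \o inl) s ++ map (inl \o inr) s) F_le.
have lt_cvg : l (t n) @[n --> \oo] --> +oo.
  have sh_incr n : (N0 + t n < N0 + t n.+1)%N by rewrite ltn_add2l.
  exact: (cvg_comp _ _ (cvg_extraction sh_incr) lcvg).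
(* The limit is set to zero off the zero set of the potential, which makes the support conditions
   immediate. Convergence there comes from the bound of u_n^2 l_n by M / (mu a), and on the zero set
   from the extraction. *)
pose u x := if a x == 0 then limn (fun n => (uv (l (t n))).1 x) else 0.
pose v x := if b x == 0 then limn (fun n => (uv (l (t n))).2 x) else 0.
have u_cvg x : (uv (l (t n))).1 x @[n --> \oo] --> u x.
  rewrite /u; case: ifPn => [/eqP ax|ax].
    have xs : x \in s by apply: s_supp; left; left.
    apply: (tP (inl (inl x))); rewrite inE mem_cat; apply/orP; right.
    by apply/orP; left; exact: (map_f (inl \o inl)).
  have c0 : 0 < mu x * a x.
    rewrite mulr_gt0 ?(mu_gt0 hG)// lt_neqAle eq_sym ax.
    exact: a_ge0 hA1 x.
  apply: (@cvg0_sqr_mul_bounded _ _ (l \o t) (M / (mu x * a x))) => // n.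
  rewrite ler_pdivlMr//; apply: le_trans (N_le (t n)).
  exact: (potential_le_normlam hG hA1 x (ltW (l_gt0 (t n))) (l_in (t n))).1.
have v_cvg x : (uv (l (t n))).2 x @[n --> \oo] --> v x.
  rewrite /v; case: ifPn => [/eqP bx|bx].
    have xs : x \in s by apply: s_supp; right; left.
    apply: (tP (inl (inr x))); rewrite inE mem_cat; apply/orP; right.
    by apply/orP; right; exact: (map_f (inl \o inr)).
  have c0 : 0 < mu x * b x.
    rewrite mulr_gt0 ?(mu_gt0 hG)// lt_neqAle eq_sym bx.
    exact: b_ge0 hA1 x.
  apply: (@cvg0_sqr_mul_bounded _ _ (l \o t) (M / (mu x * b x))) => // n.
  rewrite ler_pdivlMr//; apply: le_trans (N_le (t n)).
  exact: (potential_le_normlam hG hA1 x (ltW (l_gt0 (t n))) (l_in (t n))).2.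
have N_cvg : N (t n) @[n --> \oo] --> limn (N \o t).
  by apply: (tP (inr tt)); rewrite mem_head.
have u_out x : a x <> 0 -> u x = 0 by move=> /eqP/negPf ax; rewrite /u ax.
have v_out x : b x <> 0 -> v x = 0 by move=> /eqP/negPf bx; rewrite /v bx.
have uvH : HOm a b u v by split.
exists (fun n => N0 + t n)%N, u, v; split; [|exact: u_out|exact: v_out|exact: uvH|].
- split; first by move=> n; rewrite ltn_add2l.
  exact: (limit_strong hG alpha1 beta1 hA1 hA2 m0 mle s_uniq s_supp
    (fun n => l_gt0 (t n)) lt_cvg (fun n => l_gs (t n)) u_cvg v_cvg N_cvg uvH).
- exact: (limit_ground_state hG alpha1 beta1 hA1 hA2 m0 mle s_uniq s_supp
    (fun n => l_gt0 (t n)) lt_cvg (fun n => l_gs (t n)) u_cvg v_cvg N_cvg uvH).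
Qed.
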